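(* For integers $p>q\ge 3$ let $g(n,p,q):=g(n,K_p|\langle K_q\rangle)$. Let $t\ge 1$ and assume $p\ge 2t+3$. (i) For every fixed $t\ge 1$, $g(n,p,p-t)\le tn-\binom{t+1}{2}+1$ holds for all sufficiently large $n\ge n_0(t)$. (ii) $g(n,p,p-t)\ge tn-\binom{t+1}{2}+1$ is valid for all $n$ (with $n\ge p$), and also for $p=2t+2$. (iii) If $p>q\ge 3$, $p\le 2q-3$ and $n>(5p-5q)/2+6$ (with $n\ge p$), then $g(n,p,q)=(p-q)n-\binom{p-q+1}{2}+1$.
   Context: For a graph $F$, $\langle F\rangle$ is the family of all graphs containing $F$ as a subgraph (not necessarily induced). In an edge coloring of $K_n$ (not necessarily proper), for a copy $G'\subseteq K_n$ of a graph $G$, a color class of $G'$ is the graph formed by all edges of $G'$ having a given color that occurs in $G'$. For a family $\mathcal{F}$ of graphs with $K_2\notin\mathcal{F}$ and $n\ge|G|$, $g(n,G|\mathcal{F})$ is the largest integer $m$ for which there exists an edge coloring of $K_n$ using exactly $m$ colors such that every copy of $G$ contains a color class which is a member of $\mathcal{F}$; if no such coloring exists, then $g(n,G|\mathcal{F}):=0$. *)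

(* Defs.v *)
From mathcomp Require Import all_boot.

Set Implicit Arguments.
Unset Strict Implicit.
Unset Printing Implicit Defensive.

Record sgraph := SGraph {
  vertex :> finType;
  adj : rel vertex;
  adj_sym : symmetric adj;
  adj_irr : irreflexive adj
}.

Definition edges (G : sgraph) : {set {set G}} :=
  [set e | [exists x, exists y, adj x y && (e == [set x; y])]].

(** Not necessarily induced, and up to isomorphism. *)
Definition is_subgraph (F H : sgraph) : bool :=
  [exists f : {ffun F -> H},
     injectiveb f && [forall x, forall y, adj x y ==> adj (f x) (f y)]].

Definition containing (F : sgraph) : pred sgraph := fun H => is_subgraph F H.

Section CompleteGraph.
Variable n : nat.
Definition complete_adj : rel 'I_n := fun x y => x != y.
Lemma complete_adj_sym : symmetric complete_adj.
Proof. by move=> x y; rewrite /complete_adj eq_sym. Qed.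
Lemma complete_adj_irr : irreflexive complete_adj.
Proof. by move=> x; rewrite /complete_adj eqxx. Qed.
Definition complete : sgraph := SGraph complete_adj_sym complete_adj_irr.
End CompleteGraph.

(** The graph formed by a set of edges: its vertices are the endpoints of these
    edges, so it has no isolated vertex. *)
Section EdgeGraph.
Variables (T : finType) (E : {set {set T}}).
Definition edge_graph_vertex : finType := {x : T | x \in cover E}.
Definition edge_graph_adj : rel edge_graph_vertex :=
  fun x y => (x != y) && ([set val x; val y] \in E).
Lemma edge_graph_adj_sym : symmetric edge_graph_adj.
Proof. by move=> x y; rewrite /edge_graph_adj eq_sym setUC. Qed.
Lemma edge_graph_adj_irr : irreflexive edge_graph_adj.
Proof. by move=> x; rewrite /edge_graph_adj eqxx. Qed.
Definition edge_graph : sgraph := SGraph edge_graph_adj_sym edge_graph_adj_irr.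
End EdgeGraph.

(** A copy of [G] in K_n is the image of [G] under an injection [f]; it is
    represented by its edge set. *)
Definition copy_edges (n : nat) (G : sgraph) (f : {ffun G -> 'I_n}) :
  {set {set 'I_n}} := [set f @: (e : {set G}) | e in edges G].

Definition color_class (n m : nat) (c : {ffun {set 'I_n} -> 'I_m})
  (E : {set {set 'I_n}}) (i : 'I_m) : sgraph :=
  edge_graph [set e in E | c e == i].

(** There is an edge coloring of K_n using exactly [m] colors such that every
    copy of [G] contains a color class belonging to [F].  The values of [c] on
    sets of vertices that are not edges play no role. *)
Definition has_coloring (n : nat) (G : sgraph) (F : pred sgraph) (m : nat) :
  bool :=
  [exists c : {ffun {set 'I_n} -> 'I_m},
     (c @: edges (complete n) == [set: 'I_m]) &&
     [forall f : {ffun G -> 'I_n}, injectiveb f ==>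
        [exists i, (i \in c @: copy_edges f) &&
                   F (color_class c (copy_edges f) i)]]].

(** g(n, G | F).  The bound on [m] is harmless by [has_coloring_leq], and the
    maximum over an empty range is 0.  Meant for |G| <= n and K_2 not in [F]. *)
Definition gnum (n : nat) (G : sgraph) (F : pred sgraph) : nat :=
  \max_(m < #|edges (complete n)|.+1 | has_coloring n G F m) m.

Lemma has_coloring_leq (n : nat) (G : sgraph) (F : pred sgraph) (m : nat) :
  has_coloring n G F m -> m <= #|edges (complete n)|.
Proof.
case/existsP=> c /andP[/eqP surj _].
by rewrite -[m in m <= _]card_ord -cardsT -surj leq_imset_card.
Qed.

Definition gclique (n p q : nat) : nat :=
  gnum n (complete p) (containing (complete q)).

(* Main.v *)
Require Import Defs.
From mathcomp Require Import all_boot.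
From mathcomp Require Import zify.

(** A coloring of the complete graph in which every [p]-set of vertices spans a
    monochromatic clique on all but [t] of its vertices, with [p >= 2t + 3], has
    a monochromatic clique on all but [t] of the [n] vertices
    ([large_monochromatic_clique]).  This is obtained by enlarging [p] one
    vertex at a time ([monochromatic_clique_step]).  In a set [S] of [p + 1]
    vertices, the monochromatic cliques of size [q = p - t] found after deleting
    single vertices pairwise share at least two vertices, hence an edge, hence
    their color.  If [S] had no larger clique of this color they would be
    maximum cliques of one graph, and by Hajnal's lemma ([hajnal_cliques]) the
    sizes of their union and of their intersection add up to at least [2q].  But
    no vertex lies in all of them, and their union has at most
    [p + 1 = q + t + 1 < 2q] vertices.

    Once all the edges inside a set of [n - t] vertices have the same color, the
    number of colors is at most one plus the number of remaining edges, which is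
    [tn - 'C(t + 1, 2)].  Conversely, coloring all the edges that meet a fixed
    set of [t] vertices differently, and the others with one more color,
    attains this number: deleting at most [t] vertices from a [p]-set leaves a
    monochromatic clique.  Hence equality holds for all [n >= p >= 2t + 3],
    and the upper bound for large [n] is a special case of it. *)

Set Implicit Arguments.
Unset Strict Implicit.
Unset Printing Implicit Defensive.

(** * Maximum cliques *)

Lemma ex_subset_card (T : finType) (B : {set T}) (k : nat) :
  k <= #|B| -> exists2 A : {set T}, A \subset B & #|A| = k.
Proof.
move=> le_k; have : 0 < #|[set A : {set T} | A \subset B & #|A| == k]|.
  by rewrite cards_draws bin_gt0.
by case/card_gt0P => A; rewrite !inE => /andP[AB /eqP Ak]; exists A.
Qed.

Section Hajnal.
Variables (T : finType) (r : rel T).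
Hypothesis r_sym : symmetric r.

Definition clique (A : {set T}) :=
  [forall x in A, forall y in A, (x != y) ==> r x y].

Lemma cliqueP (A : {set T}) :
  reflect {in A &, forall x y, x != y -> r x y} (clique A).
Proof.
apply: (iffP forall_inP) => [Acl x y xA yA | Acl x xA].
  by move: (Acl x xA) => /forall_inP/(_ y yA)/implyP.
by apply/forall_inP => y yA; apply/implyP; apply: Acl.
Qed.

(** Induction on the family.  If [I] and [U] are the intersection and the union
    of the cliques considered so far, every vertex of [I] is adjacent to every
    other vertex of [U], so for a further clique [A] the set
    [I :|: (A :&: U)] is a clique.  Its size is at most [k], which says that
    [I] loses at most as many vertices as [U] gains when [A] joins the family. *)
Lemma hajnal_cliques (S A0 : {set T}) (s : seq {set T}) (k : nat) :
    (forall A : {set T}, A \subset S -> clique A -> #|A| <= k) ->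
    (forall A : {set T}, A \in A0 :: s -> [/\ A \subset S, clique A & #|A| = k]) ->
  2 * k <= #|\bigcap_(A <- A0 :: s) A| + #|\bigcup_(A <- A0 :: s) A|.
Proof.
move=> max_k; elim: s A0 => [|A1 s IH] A sP.
  by rewrite !big_seq1; have [_ _ ->] := sP A (mem_head _ _); lia.
have s1P B : B \in A1 :: s -> [/\ B \subset S, clique B & #|B| = k].
  by move=> Bs; apply: sP; rewrite inE Bs orbT.
have [AS Acl Ak] := sP A (mem_head _ _).
have {IH} := IH A1 s1P.
rewrite !(big_cons _ _ A).
set I := \bigcap_(B <- _) B; set U := \bigcup_(B <- _) B => IH.
have IP x B : x \in I -> B \in A1 :: s -> x \in B.
  by rewrite /I bigcap_seq => /bigcapP; apply.
have UP x : x \in U -> exists2 B, B \in A1 :: s & x \in B.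
  rewrite /U bigcup_seq => /bigcupP[B Bs xB]; by exists B.
have IU : I \subset U.
  apply/subsetP => x xI; rewrite /U bigcup_seq; apply/bigcupP.
  by exists A1; [rewrite inE eqxx | apply: IP; rewrite // inE eqxx].
have US : U \subset S.
  by apply/subsetP => x /UP[B /s1P[/subsetP BS _ _]]; apply: BS.
have rIU x y : x \in I -> y \in U -> x != y -> r x y.
  move=> xI /UP[B Bs yB]; have [_ Bcl _] := s1P B Bs.
  by move/cliqueP: Bcl; apply; rewrite // (IP x).
have cl : clique (I :|: (A :&: U)).
  apply/cliqueP => x y; rewrite !inE => /orP[xI | /andP[xA xU]].
    case/orP => [/(subsetP IU) yU | /andP[_ yU]]; exact: rIU.
  case/orP => [yI | /andP[yA _]]; last exact: (cliqueP _ Acl).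
  by rewrite eq_sym r_sym; apply: rIU.
have le : #|I :|: (A :&: U)| <= k.
  apply: max_k cl; rewrite subUset (subset_trans IU US).
  exact: subset_trans (subsetIl _ _) AS.
have IAU : I :&: (A :&: U) = A :&: I.
  by rewrite setICA (setIidPl IU).
have := cardsUI I (A :&: U); have := cardsUI A U; rewrite IAU.
lia.
Qed.

End Hajnal.

(** * Monochromatic cliques *)

Section Monochromatic.
Variables (T C : finType) (c : {set T} -> C).

Definition monochromatic (i : C) (A : {set T}) :=
  clique (fun x y => c [set x; y] == i) A.

Lemma monochromaticP i (A : {set T}) :
  reflect {in A &, forall x y, x != y -> c [set x; y] = i} (monochromatic i A).
Proof.
apply: (iffP (cliqueP _ _)) => Ai x y xA yA xy; apply/eqP; first exact: Ai.
by rewrite (Ai x y).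
Qed.

Lemma monochromaticS i (A B : {set T}) :
  A \subset B -> monochromatic i B -> monochromatic i A.
Proof.
move=> /subsetP AB /monochromaticP Bi.
by apply/monochromaticP => x y /AB xB /AB yB; apply: Bi.
Qed.

Lemma monochromatic_edge i (A e : {set T}) :
  monochromatic i A -> e \subset A -> #|e| = 2 -> c e = i.
Proof.
move=> /monochromaticP Ai eA /eqP/cards2P[x [y [xy def_e]]]; move: eA.
by rewrite def_e subUset !sub1set => /andP[xA yA]; apply: Ai.
Qed.

Lemma monochromatic_color i j (A B : {set T}) :
  monochromatic i A -> monochromatic j B -> 1 < #|A :&: B| -> i = j.
Proof.
move=> /monochromaticP Ai /monochromaticP Bj.
case/card_gt1P => x [y [/setIP[xA xB] /setIP[yA yB] xy]].
by rewrite -(Ai x y xA yA xy) (Bj x y xB yB xy).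
Qed.

(** The bound on [q] is used twice: two [q]-subsets of [S] share at least
    [q - t - 1 >= 2] vertices, which makes all the colors equal, and
    [2q > #|S|], which contradicts Hajnal's inequality for a family of maximum
    cliques without a common vertex. *)
Lemma monochromatic_clique_step (q t : nat) (S : {set T}) :
    t + 3 <= q -> #|S| = (q + t).+1 ->
    (forall x, x \in S ->
       exists i (A : {set _}), [/\ A \subset S :\ x, #|A| = q & monochromatic i A]) ->
  exists i (A : {set _}), [/\ A \subset S, #|A| = q.+1 & monochromatic i A].
Proof.
move=> le_tq cardS delS.
have [x0 x0S] : exists x, x \in S by apply/card_gt0P; rewrite cardS.
have [i [A0 [A0S A0q A0i]]] := delS x0 x0S.
have [/existsP[B /and3P[BS /eqP Bq Bi]] | noB] := boolP [exists B : {set T},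
    [&& B \subset S, #|B| == q.+1 & monochromatic i B]].
  by exists i, B.
have maxq (A : {set T}) : A \subset S -> monochromatic i A -> #|A| <= q.
  move=> AS Ai; rewrite leqNgt; apply/negP => /ex_subset_card[B BA Bq].
  case/negP: noB; apply/existsP; exists B.
  by rewrite (subset_trans BA AS) Bq eqxx (monochromaticS BA Ai).
have same x : x \in S -> exists A : {set T},
    [/\ A \subset S :\ x, #|A| = q & monochromatic i A].
  move=> xS; have [j [A [AS Aq Aj]]] := delS x xS.
  exists A; split=> //; rewrite (monochromatic_color A0i Aj) //.
  have US : A0 :|: A \subset S.
    rewrite subUset (subset_trans A0S (subD1set S _)).
    exact: subset_trans AS (subD1set S _).
  have := subset_leq_card US; have := cardsUI A0 A; lia.
pose F := [set A : {set T} | [&& A \subset S, monochromatic i A & #|A| == q]].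
have inF (A : {set T}) :
    reflect [/\ A \subset S, monochromatic i A & #|A| = q] (A \in F).
  by rewrite inE; apply: (iffP and3P) => -[? ? /eqP].
have sameF x : x \in S -> exists2 A : {set T}, A \in F & A \subset S :\ x.
  move=> /same[A [AS Aq Ai]]; exists A => //; apply/inF; split=> //.
  exact: subset_trans AS (subD1set _ _).
have [A1 A1F _] := sameF x0 x0S.
have famP (A : {set T}) : A \in A1 :: enum F ->
    [/\ A \subset S, monochromatic i A & #|A| = q].
  by rewrite inE mem_enum => /predU1P[-> | AF]; apply/inF.
have c_sym : symmetric (fun x y => c [set x; y] == i).
  by move=> x y; rewrite setUC.
have := hajnal_cliques c_sym maxq famP.
have -> : \bigcap_(A <- A1 :: enum F) A = set0.
  apply/setP => x; rewrite inE; apply/negbTE/negP.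
  move=> xI; have mem A : A \in A1 :: enum F -> x \in A.
    by move: xI; rewrite bigcap_seq => /bigcapP; apply.
  have xS : x \in S.
    have [/subsetP A1S _ _] := famP A1 (mem_head _ _).
    exact/A1S/mem/mem_head.
  have [A AF /subsetP/(_ x)] := sameF x xS.
  have -> : x \in A by apply: mem; rewrite inE mem_enum AF orbT.
  by rewrite !inE eqxx => /(_ isT).
have US : \bigcup_(A <- A1 :: enum F) A \subset S.
  by rewrite bigcup_seq; apply/bigcupsP => A /famP[].
by have := subset_leq_card US; rewrite cards0; lia.
Qed.

Lemma large_monochromatic_clique (p t : nat) :
    2 * t + 3 <= p -> p <= #|T| ->
    (forall S : {set T}, #|S| = p ->
       exists i (A : {set _}), [/\ A \subset S, #|A| = p - t & monochromatic i A]) ->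
  exists i (A : {set T}), #|A| = #|T| - t /\ monochromatic i A.
Proof.
move=> le_tp le_pT base.
have all d (S : {set T}) : #|S| = p + d ->
    exists i (A : {set _}), [/\ A \subset S, #|A| = p + d - t & monochromatic i A].
  elim: d S => [|d IH] S cardS; first by rewrite !addn0 in cardS *; apply: base.
  have -> : p + d.+1 - t = (p + d - t).+1 by lia.
  apply: (@monochromatic_clique_step _ t); [lia | lia | move=> x xS].
  by apply: IH; have := cardsD1 x S; rewrite xS; lia.
have [|i [A [_ cardA Ai]]] := all (#|T| - p) setT.
  by rewrite cardsT; lia.
by exists i, A; split=> //; rewrite cardA; lia.
Qed.

End Monochromatic.

(** * Copies of complete graphs *)

Lemma edges_complete n : edges (complete n) = [set e : {set 'I_n} | #|e| == 2].
Proof.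
apply/setP => e; rewrite !inE; apply/existsP/cards2P.
  by case=> x /existsP[y /andP[xy /eqP ->]]; exists x, y.
by case=> x [y [xy ->]]; exists x; apply/existsP; exists y; rewrite eqxx andbT.
Qed.

Lemma copy_edges_complete n p (f : {ffun 'I_p -> 'I_n}) (e : {set 'I_n}) :
    injective f ->
  (e \in copy_edges (G := complete p) f) =
  (e \subset f @: [set: 'I_p]) && (#|e| == 2).
Proof.
move=> inj_f; rewrite /copy_edges edges_complete; apply/imsetP/andP.
  case=> d; rewrite inE => d2 ->; split; last by rewrite card_imset.
  exact/imsetS/subsetT.
case=> ef e2; have def_e : e = f @: (f @^-1: e).
  apply/setP => x; apply/idP/imsetP => [xe | [y]].
    have /imsetP[y _ def_x] := subsetP ef x xe.
    by exists y; rewrite // inE -def_x.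
  by rewrite inE => ye ->.
by exists (f @^-1: e); rewrite // inE -(card_imset _ inj_f) -def_e.
Qed.

(** The vertices of a color class are the endpoints of its edges, so an isolated
    vertex cannot be found there: this is why [q] has to be at least 2. *)
Lemma color_class_cliqueP n m p q (c : {ffun {set 'I_n} -> 'I_m})
    (f : {ffun complete p -> 'I_n}) :
    1 < q -> injective f ->
  reflect (exists i (A : {set _}), [/\ A \subset f @: [set: 'I_p], #|A| = q &
                           monochromatic c i A])
    [exists i, (i \in c @: copy_edges f) &&
               containing (complete q) (color_class c (copy_edges f) i)].
Proof.
move=> q_gt1 inj_f; apply: (iffP existsP).
  case=> i /andP[_ /existsP[g /andP[/injectiveP inj_g /forallP g_adj]]].
  have gP x y : x != y -> [set val (g x); val (g y)]
      \in [set e in copy_edges f | c e == i].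
    move=> xy; have /forallP/(_ y)/implyP/(_ xy) := g_adj x.
    by case/andP.
  exists i, [set val (g x) | x : 'I_q]; split.
  - apply/subsetP => _ /imsetP[x _ ->].
    have /bigcupP[e] := valP (g x).
    by rewrite inE copy_edges_complete // => /andP[/andP[/subsetP ef _] _] /ef.
  - by rewrite card_imset ?card_ord //; apply: inj_comp inj_g; exact: val_inj.
  - apply/monochromaticP => _ _ /imsetP[x _ ->] /imsetP[y _ ->] xy.
    have /gP : x != y by apply: contraNneq xy => ->.
    by rewrite inE => /andP[_ /eqP].
case=> i [A [Af Aq Ai]]; exists i.
have edgeA x y : x \in A -> y \in A -> x != y ->
    [set x; y] \in [set e in copy_edges f | c e == i].
  move=> xA yA xy; rewrite inE copy_edges_complete // cards2 xy.
  rewrite (monochromaticP _ _ _ Ai) // eqxx !andbT.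
  by apply: subset_trans Af; rewrite subUset !sub1set xA.
have coverA x : x \in A -> x \in cover [set e in copy_edges f | c e == i].
  move=> xA; have : 0 < #|A :\ x| by have := cardsD1 x A; rewrite xA; lia.
  case/card_gt0P => y; rewrite !inE => /andP[yx yA].
  apply/bigcupP; exists [set x; y]; last by rewrite !inE eqxx.
  by apply: edgeA; rewrite // eq_sym.
apply/andP; split.
  have /card_gt1P[x [y [xA yA xy]]] : 1 < #|A| by rewrite Aq.
  have := edgeA x y xA yA xy; rewrite inE => /andP[e_copy /eqP <-].
  exact: imset_f.
rewrite -Aq; apply/existsP.
exists [ffun k : 'I_#|A| => exist _ (enum_val k) (coverA _ (enum_valP k))].
apply/andP; split.
  by apply/injectiveP => k l; rewrite !ffunE => /(congr1 val) /enum_val_inj.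
apply/forallP => k; apply/forallP => l; apply/implyP => kl.
have neq : enum_val k != enum_val l by rewrite (inj_eq enum_val_inj).
rewrite !ffunE; apply/andP; split; first by rewrite -val_eqE.
by apply: edgeA; rewrite ?enum_valP.
Qed.

(** * Counting edges and colors *)

Lemma bin2D (t k : nat) :
  'C(t + k, 2) = t * (t + k) - 'C(t.+1, 2) + 'C(k, 2).
Proof.
suff : 'C(t + k, 2) + 'C(t.+1, 2) = t * (t + k) + 'C(k, 2) /\
       'C(t.+1, 2) <= t * (t + k) by lia.
elim: t => [|t [IH le]]; first by rewrite mul0n addn0.
have eC m : 'C(m.+1, 2) = 'C(m, 2) + m by rewrite binS bin1.
by rewrite addSn eC (eC t.+1); nia.
Qed.

Lemma card_edges_outside (T : finType) (B : {set T}) (t : nat) :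
    t <= #|T| -> #|B| = #|T| - t ->
  #|[set e : {set T} | (#|e| == 2) && ~~ (e \subset B)]| =
  t * #|T| - 'C(t.+1, 2).
Proof.
move=> le_t cardB; set D := [set e | _].
have := cardsID (powerset B) [set e : {set T} | #|e| == 2].
have -> : [set e : {set T} | #|e| == 2] :\: powerset B = D.
  by apply/setP => e; rewrite !inE andbC.
have -> : [set e : {set T} | #|e| == 2] :&: powerset B =
          [set e : {set T} | e \subset B & #|e| == 2].
  by apply/setP => e; rewrite !inE andbC.
rewrite cards_draws card_draws cardB.
by have := bin2D t (#|T| - t); rewrite subnKC //; lia.
Qed.

Lemma leq_gnum n G F m : has_coloring n G F m -> m <= gnum n G F.
Proof.
move=> col; have lt_m := has_coloring_leq col; rewrite -ltnS in lt_m.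
exact: (@leq_bigmax_cond _ (fun k => has_coloring n G F (nat_of_ord k))
         (fun k => nat_of_ord k) (Ordinal lt_m)).
Qed.

(** Every color is that of the large monochromatic clique or occurs on one of
    the edges that are not inside this clique. *)
Lemma gclique_leq (t p n : nat) :
    2 * t + 3 <= p -> p <= n ->
  gclique n p (p - t) <= t * n - 'C(t.+1, 2) + 1.
Proof.
move=> le_tp le_pn; apply/bigmax_leqP => -[m /= _].
case/existsP => c /andP[/eqP surj /forallP copyP].
have [|S cardS|i [A [cardA Ai]]] :=
  @large_monochromatic_clique 'I_n 'I_m c p t le_tp.
- by rewrite card_ord.
- pose f : {ffun complete p -> 'I_n} :=
    [ffun k => enum_val (cast_ord (esym cardS) k)].
  have inj_f : injective f.
    by move=> k l; rewrite !ffunE => /enum_val_inj /cast_ord_inj.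
  have /implyP/(_ (introT (injectiveP f) inj_f)) := copyP f.
  have q_gt1 : 1 < p - t by lia.
  case/(color_class_cliqueP _ q_gt1 inj_f) => i [A [Af Aq Ai]].
  exists i, A; split=> //; apply: subset_trans Af _.
  by apply/subsetP => _ /imsetP[k _ ->]; rewrite ffunE enum_valP.
rewrite card_ord in cardA; rewrite -[m in m <= _]card_ord -cardsT -surj edges_complete.
set D := [set e : {set 'I_n} | (#|e| == 2) && ~~ (e \subset A)].
have cardD : #|D| = t * n - 'C(t.+1, 2).
  by rewrite (@card_edges_outside _ _ t) card_ord //; lia.
have sub : c @: [set e : {set 'I_n} | #|e| == 2] \subset i |: c @: D.
  apply/subsetP => j /imsetP[e e2 ->]; rewrite inE in e2.
  rewrite !inE; have [eA | eA] := boolP (e \subset A).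
    by rewrite (monochromatic_edge Ai eA (eqP e2)) eqxx.
  by rewrite imset_f ?orbT // inE e2.
apply: leq_trans (subset_leq_card sub) _.
rewrite cardsU1 -cardD addnC leq_add ?leq_imset_card //.
exact: leq_b1.
Qed.

Lemma leq_gclique (t p n : nat) :
    2 * t + 2 <= p -> 1 < p - t -> p <= n ->
  t * n - 'C(t.+1, 2) + 1 <= gclique n p (p - t).
Proof.
move=> le_tp q_gt1 le_pn; apply: leq_gnum; rewrite addn1.
have [B cardB] : exists B : {set 'I_n}, #|B| = n - t.
  have [|B _ cardB] := @ex_subset_card 'I_n setT (n - t); last by exists B.
  by rewrite cardsT card_ord leq_subr.
set D := [set e : {set 'I_n} | (#|e| == 2) && ~~ (e \subset B)].
have cardD : #|D| = t * n - 'C(t.+1, 2).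
  by rewrite (@card_edges_outside _ _ t) card_ord //; lia.
rewrite -cardD.
(* The shift by one keeps color 0 free for the edges inside [B]. *)
pose c : {ffun {set 'I_n} -> 'I_#|D|.+1} :=
  [ffun e => if e \in D then inord (index e (enum D)).+1 else ord0].
have Bi : monochromatic c ord0 B.
  apply/monochromaticP => x y xB yB _; rewrite ffunE inE.
  by rewrite [_ \subset B]subUset !sub1set xB yB andbF.
apply/existsP; exists c; apply/andP; split.
  rewrite edges_complete eqEsubset subsetT; apply/subsetP => j _.
  have [j0 | j_gt0] := posnP j.
    have /card_gt1P[x [y [xB yB xy]]] : 1 < #|B| by rewrite cardB; lia.
    apply/imsetP; exists [set x; y]; first by rewrite inE cards2 xy.
    by rewrite (monochromaticP _ _ _ Bi) //; apply: val_inj.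
  have lt_j : j.-1 < size (enum D) by rewrite -cardE; have := ltn_ord j; lia.
  have eD : nth set0 (enum D) j.-1 \in D by rewrite -mem_enum mem_nth.
  apply/imsetP; exists (nth set0 (enum D) j.-1).
    by move: eD; rewrite !inE => /andP[].
  by rewrite ffunE eD index_uniq ?enum_uniq // prednK // inord_val.
apply/forallP => f; apply/implyP => /injectiveP inj_f.
apply/(color_class_cliqueP _ q_gt1 inj_f).
have cardf : #|f @: [set: 'I_p]| = p by rewrite card_imset // cardsT card_ord.
have le_q : p - t <= #|f @: [set: 'I_p] :&: B|.
  have := cardsUI (f @: [set: 'I_p]) B.
  have := subset_leq_card (subsetT (f @: [set: 'I_p] :|: B)).
  by rewrite cardsT card_ord cardf cardB; lia.
have [A] := ex_subset_card le_q; rewrite subsetI => /andP[Af AB] Aq.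
by exists ord0, A; split=> //; apply: monochromaticS AB Bi.
Qed.

Theorem theorem9p22 :
  [/\ forall t : nat, 1 <= t ->
        exists n0 : nat, forall p n : nat,
          2 * t + 3 <= p -> p <= n -> n0 <= n ->
          gclique n p (p - t) <= t * n - 'C(t.+1, 2) + 1,
      forall t p n : nat, 1 <= t ->
        2 * t + 3 <= p \/ p = 2 * t + 2 -> p <= n ->
        t * n - 'C(t.+1, 2) + 1 <= gclique n p (p - t)
    & forall p q n : nat,
        3 <= q -> q < p -> p <= 2 * q - 3 -> p <= n ->
        5 * p - 5 * q + 2 * 6 < 2 * n ->
        gclique n p q = (p - q) * n - 'C((p - q).+1, 2) + 1].
Proof.
split=> [t _ | t p n t_gt0 le_tp le_pn | p q n _ lt_qp le_p le_pn _].
- by exists 0 => p n le_tp le_pn _; apply: gclique_leq.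
- by apply: leq_gclique => //; lia.
- have def_q : q = p - (p - q) by lia.
  rewrite {1}def_q; apply/eqP; rewrite eqn_leq gclique_leq ?leq_gclique //; lia.
Qed.
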